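(* Let $X=\ell_2(\mathbb{N})$ with orthonormal basis $(e_n)_{n\in\mathbb{N}}$, and let $(\theta_n)_{n\in\mathbb{N}}$ be a decreasing sequence of angles in $\left]0,\pi/2\right[$ with $\theta_n\to0$. Let $\mathcal{L}=\{L_1,L_2\}$, where $$L_1:=\overline{\operatorname{span}}\{\cos(\theta_k)e_{2k-1}+\sin(\theta_k)e_{2k}\mid k\in\mathbb{N}\smallsetminus\{0\}\},\qquad L_2:=\overline{\operatorname{span}}\{e_{2k+1}\mid k\in\mathbb{N}\}.$$ Then, for every $x=(x_0,x_1,x_2,\ldots)\in X$: (i) $P_{L_1}x=\sum_{k\in\mathbb{N}\smallsetminus\{0\}}\big(x_{2k-1}\cos(\theta_k)+x_{2k}\sin(\theta_k)\big)\big(e_{2k-1}\cos(\theta_k)+e_{2k}\sin(\theta_k)\big)$. (ii) $P_{L_2}x=(0,x_1,0,x_3,0,x_5,\dots)$. (iii) $\mathcal{L}$ is not innately regular. Let $x^{(0)}:=(0,x_1,0,x_3,0,x_5,\dots)\in\ell_2(\mathbb{N})$ and generate the sequence of alternating projections via $x^{(2n+1)}:=P_{L_1}x^{(2n)}$ and $x^{(2n+2)}:=P_{L_2}x^{(2n+1)}$ for $n\in\mathbb{N}$. Then: (iv) For all $n\in\mathbb{N}\smallsetminus\{0\}$ and all $k\in\mathbb{N}\smallsetminus\{0\}$, $$x^{(2n-1)}_0=0,\quad x^{(2n-1)}_{2k-1}=x_{2k-1}\cos^{2n}(\theta_k),\quad x^{(2n-1)}_{2k}=x_{2k-1}\cos^{2n-1}(\theta_k)\sin(\theta_k),$$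 and $$x^{(2n)}_{2k-2}=0,\quad x^{(2n)}_{2k-1}=x_{2k-1}\cos^{2n}(\theta_k).$$ (v) For all $n\in\mathbb{N}\smallsetminus\{0\}$: $\|x^{(2n)}-x^{(2n-1)}\|^2=\sum_{k=1}^\infty x_{2k-1}^2\cos^{4n}(\theta_k)\big(\cos^{-2}(\theta_k)-1\big)$. Suppose in addition that $\theta_0\in\left]0,\pi/2\right[$, and that for all $k\in\mathbb{N}\smallsetminus\{0\}$, $\theta_k:=\arccos\Big(\big(\tfrac{k}{k+1}\big)^{\frac{1}{4e^k}}\Big)$ and $x_{2k-1}:=\frac{1}{k^2}$. Then: (vi) For all $\gamma\in\left]0,2\right[$: $\displaystyle\sum_{n=0}^\infty\|x^{(n+1)}-x^{(n)}\|^\gamma=+\infty$.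
   Context: $\mathbb{N}=\{0,1,2,\ldots\}$. $P_L$ denotes the orthogonal (nearest-point) projector onto a closed linear subspace $L$. For $x\in\ell_2(\mathbb{N})$, $x_j$ denotes its $j$-th coordinate with respect to $(e_n)_{n\in\mathbb{N}}$, and $x^{(n)}_j$ denotes the $j$-th coordinate of the iterate $x^{(n)}$. $\overline{\operatorname{span}}$ denotes the closed linear span. A nonempty finite collection $\mathcal{L}$ of closed linear subspaces of a real Hilbert space is innately regular if whenever $L_1,\ldots,L_k$ are drawn from $\mathcal{L}$, the sum $\sum_{i=1}^k L_i^\perp$ is closed. *)

(* Defs.v *)
From HB Require Import structures.
From mathcomp Require Import all_boot all_order all_algebra.
From mathcomp Require Import all_classical all_reals all_analysis.
From mathcomp Require Import ring lra.

Set Implicit Arguments.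
Unset Strict Implicit.
Unset Printing Implicit Defensive.

Import Order.TTheory GRing.Theory Num.Theory.
Import numFieldNormedType.Exports.

Local Open Scope classical_set_scope.
Local Open Scope ring_scope.

HB.mixin Record CompleteNormedModule_isHilbert (R : realType) V
    & CompleteNormedModule R V := {
  inner : V -> V -> R ;
  innerC : forall x y, inner x y = inner y x ;
  innerDl : forall x y z, inner (x + y) z = inner x z + inner y z ;
  innerZl : forall a x y, inner (a *: x) y = a * inner x y ;
  innerxx : forall x, inner x x = `|x| ^+ 2
}.

#[short(type="hilbertType")]
HB.structure Definition Hilbert (R : realType) :=
  {V of CompleteNormedModule R V & CompleteNormedModule_isHilbert R V}.

Section hilbert_notions.
Variables (R : realType) (V : hilbertType R).
Implicit Types (L A : set V) (x : V).

Definition nearest_points L x : set V :=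
  [set p | L p /\ forall y, L y -> `|x - p| <= `|x - y|].

(* When L is a closed linear subspace, nearest_points L x is a singleton; the
   value 0 is only a default for the other sets. *)
Definition projector L x : V := xget 0 (nearest_points L x).

Definition lin_span A : set V :=
  [set v | exists n (c : 'I_n -> R) (u : 'I_n -> V),
    (forall i, A (u i)) /\ v = \sum_(i < n) c i *: u i].

Definition closed_span A : set V := closure (lin_span A).

Definition orth A : set V := [set y | forall a, A a -> inner a y = 0].

Definition minkowski_sum k (S : 'I_k -> set V) : set V :=
  [set v | exists u : 'I_k -> V, (forall i, S i (u i)) /\ v = \sum_i u i].

(* The family L ranges over all finite families of members of LL: members may
   be repeated and need not exhaust LL (k = 0 is harmless: {0} is closed). *)
Definition innately_regular (LL : set (set V)) : Prop :=
  forall k (L : 'I_k -> set V), (forall i, LL (L i)) ->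
    closed (minkowski_sum (fun i => orth (L i))).

End hilbert_notions.

Section ell2_type.
Variable R : realType.
Implicit Types (x y z : nat -> R).

Definition square_summable x : Prop := cvgn (series (fun n => x n ^+ 2)).

Definition ell2_pred : {pred nat -> R} := fun x => `[< square_summable x >].

Record ell2 := Ell2 { ell2_val :> nat -> R ; _ : ell2_val \in ell2_pred }.

HB.instance Definition _ := [isSub for ell2_val].
HB.instance Definition _ := [Choice of ell2 by <:].

Lemma square_summableP x : reflect (square_summable x) (x \in ell2_pred).
Proof. by rewrite unfold_in; apply: asboolP. Qed.

Lemma ell2_subproof (x : ell2) : square_summable x.
Proof. by apply/square_summableP; case: x. Qed.

Lemma square_summable0 : square_summable (0 : nat -> R).
Proof.
rewrite /square_summable (_ : series _ = cst 0); first exact: is_cvg_cst.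
apply/funext => n; rewrite /series/= big1// => i _.
by rewrite -[X in X ^+ 2]/(0 : R) expr0n.
Qed.

Lemma square_summableZD a x y : square_summable x -> square_summable y ->
  square_summable (a *: x + y).
Proof.
move=> cx cy.
have c : cvgn (series ((2 * a ^+ 2) *: (fun n => x n ^+ 2) +
                       2 *: (fun n => y n ^+ 2))).
  by apply: is_cvg_seriesD; apply: is_cvg_seriesZ.
apply: (series_le_cvg _ _ _ c) => n /=.
- exact: sqr_ge0.
- rewrite !fctE /= /GRing.scale/=.
  by rewrite addr_ge0// mulr_ge0// ?sqr_ge0// mulr_ge0// sqr_ge0.
- rewrite !fctE /= /GRing.scale/=.
  have := sqr_ge0 (a * x n - y n); nra.
Qed.

Lemma ell2_submod_closed : GRing.submod_closed ell2_pred.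
Proof.
split; first exact/square_summableP/square_summable0.
move=> a x y /square_summableP cx /square_summableP cy.
exact/square_summableP/square_summableZD.
Qed.

HB.instance Definition _ :=
  GRing.isSubmodClosed.Build R (nat -> R) ell2_pred ell2_submod_closed.
HB.instance Definition _ := [SubChoice_isSubZmodule of ell2 by <:].
HB.instance Definition _ := [SubZmodule_isSubLmodule of ell2 by <:].

End ell2_type.

Section ell2_hilbert.
Variable R : realType.
Notation ell2 := (ell2 R).
Implicit Types x y z : ell2.

Lemma ell2D (x y : ell2) n : (x + y) n = x n + y n.
Proof. by []. Qed.

Lemma ell2Z a (x : ell2) n : (a *: x) n = a * x n.
Proof. by []. Qed.

Lemma ell2N (x : ell2) n : (- x) n = - x n.
Proof. by []. Qed.

Lemma ell2B (x y : ell2) n : (x - y) n = x n - y n.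
Proof. by []. Qed.

Lemma ell2_0 n : (0 : ell2) n = 0.
Proof. by []. Qed.

Lemma ell2P (x y : ell2) : (forall n, x n = y n) -> x = y.
Proof. by move=> xy; apply/val_inj/funext. Qed.

Lemma is_cvg_ell2_mul (x y : ell2) : cvgn (series (fun n => x n * y n)).
Proof.
have c : cvgn (series ((fun n => x n ^+ 2) + (fun n => y n ^+ 2))).
  by apply: is_cvg_seriesD; exact: ell2_subproof.
apply: normed_cvg; apply: (series_le_cvg _ _ _ c) => n /=.
- by [].
- by rewrite addr_ge0// sqr_ge0.
- rewrite ler_norml; have := sqr_ge0 (x n - y n); have := sqr_ge0 (x n + y n).
  rewrite !fctE => h1 h2; apply/andP; split; nra.
Qed.

Definition ell2_inner (x y : ell2) : R :=
  limn (series (fun n => x n * y n)).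

Definition ell2_norm (x : ell2) : R := Num.sqrt (ell2_inner x x).

Lemma ell2_innerC x y : ell2_inner x y = ell2_inner y x.
Proof.
by rewrite /ell2_inner; congr (limn (series _)); apply/funext => n; rewrite mulrC.
Qed.

Lemma ell2_innerDl x y z :
  ell2_inner (x + y) z = ell2_inner x z + ell2_inner y z.
Proof.
rewrite /ell2_inner -lim_seriesD; [|exact: is_cvg_ell2_mul..].
by congr (limn (series _)); apply/funext => n; rewrite fctE -mulrDl.
Qed.

Lemma ell2_innerZl a x y : ell2_inner (a *: x) y = a * ell2_inner x y.
Proof.
rewrite /ell2_inner.
rewrite -[RHS](lim_seriesZ a (@is_cvg_ell2_mul x y)).
by congr (limn (series _)); apply/funext => n; rewrite fctE /= -[RHS]/(a * _) mulrA.
Qed.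

Lemma ell2_partial_le x N :
  \sum_(0 <= n < N) x n ^+ 2 <= ell2_inner x x.
Proof.
have e : (fun n => x n * x n) = (fun n => x n ^+ 2) by apply/funext.
rewrite /ell2_inner e.
apply: (nondecreasing_cvgn_le (u_ := series (fun n => x n ^+ 2))).
  by apply: nondecreasing_series => n _ _; exact: sqr_ge0.
exact: ell2_subproof.
Qed.

Lemma ell2_inner_ge0 x : 0 <= ell2_inner x x.
Proof. by have := ell2_partial_le x 0; rewrite big_geq. Qed.

Lemma ell2_normE x : ell2_norm x ^+ 2 = ell2_inner x x.
Proof. by rewrite sqr_sqrtr// ell2_inner_ge0. Qed.

Lemma ell2_norm_ge0 x : 0 <= ell2_norm x.
Proof. exact: sqrtr_ge0. Qed.

Lemma ell2_coord_le x n : `|x n| <= ell2_norm x.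
Proof.
rewrite -(ler_pXn2r (n := 2))// ?nnegrE ?ell2_norm_ge0//.
rewrite ell2_normE real_normK ?num_real//.
apply: le_trans (ell2_partial_le x n.+1).
by rewrite big_nat_recr//= lerDr sumr_ge0// => i _; exact: sqr_ge0.
Qed.

Lemma ell2_cauchy_schwarz x y :
  ell2_inner x y <= ell2_norm x * ell2_norm y.
Proof.
set a := ell2_norm x; set b := ell2_norm y.
have a0 : 0 <= a := ell2_norm_ge0 x.
have b0 : 0 <= b := ell2_norm_ge0 y.
have H s t : 0 <= s ^+ 2 * a ^+ 2 + 2 * s * t * ell2_inner x y + t ^+ 2 * b ^+ 2.
  have := ell2_inner_ge0 (s *: x + t *: y).
  rewrite ell2_innerDl !ell2_innerZl ![ell2_inner _ (_ + _)]ell2_innerC.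
  rewrite !ell2_innerDl !ell2_innerZl (ell2_innerC y x) !ell2_normE.
  by congr (0 <= _); ring.
have [a_eq0|a_neq0] := eqVneq a 0.
  have xn n : x n = 0.
    apply/normr0_eq0/eqP; rewrite eq_le normr_ge0 andbT.
    by rewrite -a_eq0 ell2_coord_le.
  rewrite a_eq0 mul0r /ell2_inner (_ : (fun _ => _) = 0 *: (fun n => x n * y n)).
    rewrite lim_seriesZ; last exact: is_cvg_ell2_mul.
    by rewrite scale0r.
  by apply/funext => n; rewrite xn mul0r scale0r.
have [b_eq0|b_neq0] := eqVneq b 0.
  have yn n : y n = 0.
    apply/normr0_eq0/eqP; rewrite eq_le normr_ge0 andbT.
    by rewrite -b_eq0 ell2_coord_le.
  rewrite b_eq0 mulr0 /ell2_inner (_ : (fun _ => _) = 0 *: (fun n => x n * y n)).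
    rewrite lim_seriesZ; last exact: is_cvg_ell2_mul.
    by rewrite scale0r.
  by apply/funext => n; rewrite yn mulr0 scale0r.
have ab : 0 < a * b by rewrite mulr_gt0// lt_def ?a_neq0 ?b_neq0.
rewrite -(ler_pM2l ab).
have := H b (- a); nra.
Qed.

Lemma ell2_normD x y : ell2_norm (x + y) <= ell2_norm x + ell2_norm y.
Proof.
rewrite -(ler_pXn2r (n := 2))// ?nnegrE ?addr_ge0 ?ell2_norm_ge0//.
rewrite ell2_normE ell2_innerDl ![ell2_inner _ (_ + _)]ell2_innerC !ell2_innerDl.
rewrite (ell2_innerC y x) -!ell2_normE.
have := ell2_cauchy_schwarz x y; nra.
Qed.

Lemma ell2_normZ a x : ell2_norm (a *: x) = `|a| * ell2_norm x.
Proof.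
rewrite /ell2_norm ell2_innerZl ell2_innerC ell2_innerZl mulrA -expr2.
by rewrite sqrtrM ?sqr_ge0// sqrtr_sqr.
Qed.

Lemma ell2_norm_eq0 x : ell2_norm x = 0 -> x = 0.
Proof.
move=> x0; apply: ell2P => n; apply/normr0_eq0/eqP.
by rewrite eq_le normr_ge0 andbT -x0 ell2_coord_le.
Qed.

HB.instance Definition _ :=
  Lmodule_isNormed.Build R ell2 ell2_normD ell2_normZ ell2_norm_eq0.

Lemma ell2_norm_bound x (e : R) : 0 <= e ->
  (forall N, \sum_(0 <= n < N) x n ^+ 2 <= e ^+ 2) -> `|x| <= e.
Proof.
move=> e0 H; rewrite -[`|x|]/(ell2_norm x).
rewrite -(ler_pXn2r (n := 2))// ?nnegrE ?ell2_norm_ge0// ell2_normE.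
have c : cvgn (series (fun n => x n * x n)) by exact: is_cvg_ell2_mul.
apply: (limr_le c); apply: nearW => N; exact: H.
Qed.

Lemma ell2_complete (F : set_system ell2) :
  ProperFilter F -> cauchy F -> cvg F.
Proof.
move=> FF cF.
have cB (e : R) : 0 < e -> \forall x & y \near F, `|x - y| < e.
  move=> e0; have /cauchy_ballP/(_ _ e0) := cF.
  by apply: filterS => -[x y] /=; rewrite -ball_normE.
have coordc n : cvg ((fun x : ell2 => x n) @ F).
  apply/cauchy_cvgP/cauchy_ballP => e e0; near_simpl.
  apply: filterS (cB _ e0) => -[x y] /= xy; rewrite /ball/=.
  by rewrite -ell2B (le_lt_trans (ell2_coord_le _ _)).
pose l n := lim ((fun x : ell2 => x n) @ F).
have lP n : (fun x : ell2 => x n) @ F --> l n by exact: coordc.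
have bound (e : R) : 0 < e -> \forall x \near F,
    forall N, \sum_(0 <= n < N) ((x : ell2) n - l n) ^+ 2 <= e ^+ 2.
  move=> e0.
  have h : \forall x \near F, \forall y \near F, `|x - y| < e.
    by apply: nearP_dep; exact: cB.
  apply: filterS h => x /= hx N.
  have c : (fun y : ell2 => \sum_(0 <= n < N) (x n - y n) ^+ 2) @ F -->
      \sum_(0 <= n < N) (x n - l n) ^+ 2.
    apply: (cvg_big (op := +%R)) => [|n _]; first exact: add_continuous.
    rewrite expr2; under eq_cvg do rewrite expr2.
    by apply: cvgM; apply: cvgB => //; exact: cvg_cst.
  rewrite -(cvg_lim _ c)//; apply: limr_le; first by apply/cvg_ex; eexists; exact: c.
  apply: filterS hx => y /ltW xy.
  have /le_trans -> // := ell2_partial_le (x - y) N.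
  rewrite -ell2_normE ler_pXn2r ?nnegrE ?ell2_norm_ge0//.
  exact: ltW.
have [x0 hx0] := @filter_ex _ _ _ _ (bound 1 ltr01).
have s0 : square_summable (fun n => x0 n - l n).
  apply: nondecreasing_is_cvgn.
    by apply: nondecreasing_series => n _ _; exact: sqr_ge0.
  by exists (1 ^+ 2) => _ [N _ <-]; exact: hx0.
have sl : square_summable l.
  have := @square_summableZD _ (-1) _ _ s0 (@ell2_subproof _ x0).
  congr (square_summable _); apply/funext => n; rewrite !fctE /=.
  by rewrite scaleN1r opprB subrK.
have /square_summableP lin := sl.
pose ll : ell2 := Ell2 lin.
apply/cvg_ex; exists ll; apply/cvgrPdist_le => e e0.
apply: filterS (bound _ e0) => x hx; rewrite distrC.
by apply: ell2_norm_bound => //; exact: ltW.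
Unshelve. all: by end_near. Qed.

HB.instance Definition _ := Uniform_isComplete.Build ell2 ell2_complete.

Lemma ell2_innerxx (x : ell2) : ell2_inner x x = `|x| ^+ 2.
Proof. by rewrite -[`|x|]/(ell2_norm x) ell2_normE. Qed.

HB.instance Definition _ := CompleteNormedModule_isHilbert.Build R ell2
  ell2_innerC ell2_innerDl ell2_innerZl ell2_innerxx.

Lemma square_summable_delta k : square_summable (fun j => (j == k)%:R : R).
Proof.
apply: (is_cvg_near_cst (1 : R)); exists k.+1 => // N /= kN.
rewrite /series/= (bigD1_seq k) ?iota_uniq ?mem_index_iota//= eqxx expr1n.
by rewrite big1 ?addr0// => j /negPf ->; rewrite expr0n.
Qed.

Definition e_ k : ell2 :=
  Ell2 (introT (square_summableP _) (@square_summable_delta k)).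

End ell2_hilbert.
Arguments e_ {R} k%_N.

(* Main.v *)
(* L1 is spanned by the orthonormal vectors cos(theta_k) e_(2k-1) + sin(theta_k)
   e_(2k) and L2 by the e_(2k+1), so both projectors are given by their Fourier
   series, and the alternating projections decouple into planes where one step
   multiplies the odd coordinate by cos(theta_k).

   Every e_(2k-1) lies in L1^perp + L2^perp, hence so does any vector with odd
   support up to closure.  If x = u + v with u in L1^perp and v in L2^perp, then
   cos(theta_k) x_(2k-1) = - sin(theta_k) u_(2k), which is impossible for
   x_(2k-1)^2 = sin(theta_k) - sin(theta_(k+1)): summing over k >= m gives
   cos(theta_1)^2 sin(theta_m) <= sin(theta_m)^2 |u|^2.

   For the divergence, keep only the k-th term of |x^(2n) - x^(2n-1)|^2: it is at
   least 1 / (8 k^5 exp(k)) for 0 < n <= exp(k), so these n contribute at least a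
   constant times exp((1 - gamma / 2) k) / k^5. *)
Require Import Defs.
From HB Require Import structures.
From mathcomp Require Import all_boot all_order all_algebra.
From mathcomp Require Import all_classical all_reals all_analysis.
From mathcomp Require Import ring lra.

Set Implicit Arguments.
Unset Strict Implicit.
Unset Printing Implicit Defensive.

Import Order.TTheory GRing.Theory Num.Theory.
Import numFieldNormedType.Exports.

Local Open Scope classical_set_scope.
Local Open Scope ring_scope.

(** * Inner products: Cauchy-Schwarz, and projections characterized by orthogonality *)

Section inner_product.
Variables (R : realType) (V : hilbertType R).
Implicit Types x y z p : V.

Lemma inner0l y : inner (0 : V) y = 0.
Proof. by rewrite -(scale0r (0 : V)) innerZl mul0r. Qed.

Lemma innerNl x y : inner (- x) y = - inner x y.
Proof. by rewrite -scaleN1r innerZl mulN1r. Qed.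

Lemma innerDr x y z : inner x (y + z) = inner x y + inner x z.
Proof. by rewrite innerC innerDl !(innerC x). Qed.

Lemma innerZr a x y : inner x (a *: y) = a * inner x y.
Proof. by rewrite innerC innerZl innerC. Qed.

Lemma innerBr x y z : inner x (y - z) = inner x y - inner x z.
Proof. by rewrite innerDr -scaleN1r innerZr mulN1r. Qed.

Lemma inner_suml I (r : seq I) (P : pred I) (u : I -> V) y :
  inner (\sum_(i <- r | P i) u i) y = \sum_(i <- r | P i) inner (u i) y.
Proof.
by apply: (big_morph (fun z => inner z y)) => [? ?|]; rewrite ?innerDl ?inner0l.
Qed.

Lemma inner_sumr I (r : seq I) (P : pred I) (u : I -> V) y :
  inner y (\sum_(i <- r | P i) u i) = \sum_(i <- r | P i) inner y (u i).
Proof. by rewrite innerC inner_suml; apply: eq_bigr => i _; rewrite innerC. Qed.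

Lemma normD_sqr x y : `|x + y| ^+ 2 = `|x| ^+ 2 + 2 * inner x y + `|y| ^+ 2.
Proof. by rewrite -!innerxx innerDl !innerDr (innerC y x); ring. Qed.

(** The squared norm of [|y|^2 x - <x,y> y] equals [|y|^2 (|x|^2 |y|^2 - <x,y>^2)], and it is
    nonnegative. *)
Lemma inner_le_norm x y : `|inner x y| <= `|x| * `|y|.
Proof.
have [->|y0] := eqVneq y 0.
  by rewrite innerC inner0l !normr0 mulr0.
have y_gt0 : 0 < `|y| by rewrite normr_gt0.
rewrite -(ler_pXn2r (n := 2))// ?nnegrE ?mulr_ge0// real_normK ?num_real//.
have := sqr_ge0 `| `|y| ^+ 2 *: x - inner x y *: y|.
rewrite normD_sqr -scaleNr innerZl innerZr !normrZ !exprMn ?real_normK ?num_real//.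
rewrite sqrrN => h.
rewrite -subr_ge0 -(pmulr_rge0 _ (exprn_gt0 2 y_gt0)).
by apply: le_trans h _; rewrite le_eqVlt; apply/orP; left; apply/eqP; ring.
Qed.

Lemma cvg_inner (u : nat -> V) x y :
  u @ \oo --> x -> (fun n => inner y (u n)) @ \oo --> inner y x.
Proof.
move=> ux; apply/cvgrPdist_le => e e0.
(* Adding 1 keeps the divisor nonzero when [y] is 0. *)
have y1 : 0 < `|y| + 1 by rewrite ltr_wpDl.
move/cvgrPdist_le: ux => /(_ (e / (`|y| + 1))); rewrite divr_gt0// => /(_ isT).
apply: filterS => n h /=. rewrite -innerBr (le_trans (inner_le_norm _ _))//.
rewrite (le_trans (ler_wpM2l _ h))// mulrC -mulrA ger_pMr//.
by rewrite mulrC ler_pdivrMr// mul1r lerDl.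
Qed.

(** A combination [w] of elements of [A] within [e / (|y| + 1)] of [p] is orthogonal to [y], so
    Cauchy-Schwarz gives [|<p,y>| <= e]. *)
Lemma inner_closed_span_eq0 (A : set V) y :
  (forall a, A a -> inner a y = 0) ->
  forall p, closed_span A p -> inner p y = 0.
Proof.
move=> Ay p cp; apply/normr0_eq0/eqP; rewrite eq_le normr_ge0 andbT.
apply/ler_addgt0Pr => e e0; rewrite add0r.
have y1 : 0 < `|y| + 1 by rewrite ltr_wpDl.
have [_ [[m [c [u [Au ->]]]]]] := cp _ (nbhsx_ballx p _ (divr_gt0 e0 y1)).
set w := \sum_(i < m) _ => /=; rewrite -ball_normE/= => /ltW pw.
have w0 : inner w y = 0.
  by rewrite inner_suml big1// => i _; rewrite innerZl Ay ?mulr0.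
rewrite -(subr0 (inner p y)) -w0 -innerNl -innerDl.
rewrite (le_trans (inner_le_norm _ _))// (le_trans (ler_wpM2r _ pw))//.
by rewrite -mulrA ger_pMr// mulrC ler_pdivrMr// mul1r lerDl.
Qed.

(** Pythagoras with right angle at [p] gives minimality, and also uniqueness: another minimizer [q]
    has [|p - q| = 0]. *)
Lemma projector_closed_spanE (A : set V) x p : closed_span A p ->
  (forall a, A a -> inner a (x - p) = 0) -> projector (closed_span A) x = p.
Proof.
move=> Ap orthA.
have pyth y : closed_span A y -> `|x - y| ^+ 2 = `|x - p| ^+ 2 + `|p - y| ^+ 2.
  move=> Ay; rewrite -[x - y](subrKA p) [LHS]normD_sqr innerBr.
  by rewrite !(innerC (x - p)) !(inner_closed_span_eq0 orthA)// subrr mulr0 addr0.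
rewrite /projector; apply: xget_unique => [|q [Aq /(_ _ Ap) qmin]].
  split=> // y Ay; rewrite -(ler_pXn2r (n := 2))// ?nnegrE//.
  by rewrite (pyth y)// lerDl sqr_ge0.
apply/eqP; rewrite eq_sym -subr_eq0 -normr_eq0 -sqrf_eq0 eq_le sqr_ge0 andbT.
rewrite -(lerD2l (`|x - p| ^+ 2)) -pyth// addr0.
by rewrite ler_pXn2r// nnegrE.
Qed.

End inner_product.

(** * Fourier series of the projection onto the closed span of an orthonormal sequence *)

Section orthonormal_sequence.
Variables (R : realType) (V : hilbertType R) (v : nat -> V).
Hypothesis v_orthonormal : forall i j, inner (v i) (v j) = (i == j)%:R.
Variable x : V.

Let c k := inner x (v k).
Let S n := \sum_(0 <= k < n) c k *: v k.

Let inner_S k n : (k < n)%N -> inner (v k) (S n) = c k.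
Proof.
move=> kn; rewrite inner_sumr (bigD1_seq k) ?iota_uniq ?mem_index_iota//=.
rewrite innerZr v_orthonormal eqxx mulr1 big1 ?addr0// => j jk.
by rewrite innerZr v_orthonormal eq_sym (negPf jk) mulr0.
Qed.

Let norm_sum m n : `|\sum_(m <= k < n) c k *: v k| ^+ 2 = \sum_(m <= k < n) c k ^+ 2.
Proof.
rewrite -innerxx inner_suml [LHS]big_seq [RHS]big_seq; apply: eq_bigr => k.
move=> kmn; rewrite innerZl inner_sumr (bigD1_seq k) ?iota_uniq//=.
rewrite innerZr v_orthonormal eqxx mulr1 big1 ?addr0// => j jk.
by rewrite innerZr v_orthonormal eq_sym (negPf jk) mulr0.
Qed.

(** The remainder [x - S n] is orthogonal to [S n], so Pythagoras bounds [|S n|] by [|x|]. *)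
Lemma bessel_inequality n : \sum_(0 <= k < n) inner x (v k) ^+ 2 <= `|x| ^+ 2.
Proof.
have : `|x - S n + S n| ^+ 2 = `|x - S n| ^+ 2 + `|S n| ^+ 2.
  rewrite normD_sqr inner_sumr big_nat big1 ?mulr0 ?addr0// => k /andP[_ kn].
  by rewrite innerZr innerC innerBr inner_S// innerC subrr mulr0.
by rewrite subrK norm_sum => ->; rewrite lerDr sqr_ge0.
Qed.

(** By Bessel the squared coefficients are summable; [norm_sum] carries their Cauchy criterion over
    to [S], and [V] is complete. *)
Let cvg_S : cvgn S.
Proof.
have : cvgn (series (fun k => c k ^+ 2)).
  apply: nondecreasing_is_cvgn.
    by apply: nondecreasing_series => n _ _; exact: sqr_ge0.
  by exists (`|x| ^+ 2) => _ [N _ <-]; exact: bessel_inequality.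
move/cauchy_cvgP/cauchy_seriesP => h.
apply/cauchy_cvgP/cauchy_seriesP => e e0.
apply: filterS (h _ (exprn_gt0 2 e0)) => -[m n] /=.
rewrite -norm_sum ger0_norm ?sqr_ge0//.
by rewrite ltr_pXn2r// nnegrE// ltW.
Qed.

Let p := limn S.

Let limS_span : closed_span (range v) p.
Proof.
apply: (@closed_cvg _ _ \oo _ S) => //; first exact: closed_closure.
apply: nearW => n; apply: subset_closure; exists n, (fun i => c i), (fun i => v i).
by split=> [i|]; [exists i | rewrite /S big_mkord].
Qed.

(** The inner product of [v k] with [S n] is constantly [c k] once [n > k], and it passes to the
    limit by continuity. *)
Let limS_orth k : inner (v k) (x - p) = 0.
Proof.
rewrite innerBr innerC; apply/eqP; rewrite subr_eq0; apply/eqP/esym.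
have h : (fun n => inner (v k) (S n)) @ \oo --> inner (v k) p by exact: cvg_inner.
rewrite -(cvg_lim _ h)//; apply: lim_near_cst => //.
by near=> n; rewrite inner_S//; near: n; exact: nbhs_infty_gt.
Unshelve. all: by end_near. Qed.

Let limSE : projector (closed_span (range v)) x = p.
Proof.
by apply: projector_closed_spanE => // _ [k _ <-]; exact: limS_orth.
Qed.

Lemma projector_in_closed_span :
  closed_span (range v) (projector (closed_span (range v)) x).
Proof. by rewrite limSE. Qed.

Lemma inner_projector k :
  inner (v k) (projector (closed_span (range v)) x) = inner (v k) x.
Proof.
by apply/eqP; rewrite eq_sym -subr_eq0 -innerBr limSE limS_orth.
Qed.

Lemma cvg_projector : (fun n => \sum_(0 <= k < n) inner x (v k) *: v k) @ \oo -->
  projector (closed_span (range v)) x.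
Proof. by rewrite limSE. Qed.

End orthonormal_sequence.
Arguments projector_in_closed_span {R V v} _ x.
Arguments cvg_projector {R V v} _ x.

(** * Coordinates of the two projections in ell2 *)

Section ell2_coordinates.
Variable R : realType.
Implicit Types (x y : ell2 R) (i j k n : nat).

Lemma inner_e x k : inner (e_ k) x = x k.
Proof.
apply: lim_near_cst => //; exists k.+1 => // n /= kn.
rewrite /series/= (bigD1_seq k) ?iota_uniq ?mem_index_iota//= eqxx mul1r.
by rewrite big1 ?addr0// => j /negPf ->; rewrite mul0r.
Qed.

Lemma cvg_sum_sqr x : (fun n => \sum_(0 <= j < n) x j ^+ 2) @ \oo --> `|x| ^+ 2.
Proof.
have <- : limn (series (fun j => x j ^+ 2)) = `|x| ^+ 2.
  rewrite -innerxx -[inner _ _]/(ell2_inner _ _) /ell2_inner.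
  by congr (limn (series _)); apply/funext => j; rewrite expr2.
exact: ell2_subproof.
Qed.

(** Each pair of indices spans the plane that contains one generator of L1; index 0 stays alone. *)
Lemma sum_nat_double (f : nat -> R) n :
  \sum_(0 <= j < (2 * n).+1) f j =
  f 0%N + \sum_(0 <= k < n) (f (2 * k).+1 + f (2 * k).+2).
Proof.
elim: n => [|n IH]; first by rewrite big_nat1 big_geq// addr0.
by rewrite mulnS 2?big_nat_recr//= IH [in RHS]big_nat_recr//= -!addrA.
Qed.

Lemma e_odd_orthonormal i j :
  inner (e_ (2 * i).+1) (e_ (2 * j).+1 : ell2 R) = (i == j)%:R.
Proof. by rewrite inner_e/= eqSS eqn_mul2l. Qed.

(** Odd coordinates are inner products with the generators, which the projection preserves; an even
    basis vector is orthogonal to all generators. *)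
Lemma projector_odd x j :
  projector (closed_span (range (fun k => e_ (2 * k).+1))) x j =
  if odd j then x j else 0.
Proof.
case: ifPn => oddj.
  have -> : j = (2 * j./2).+1 by rewrite mul2n -[LHS]odd_double_half oddj.
  by rewrite -!inner_e; apply: (inner_projector e_odd_orthonormal).
rewrite -inner_e innerC.
apply: (inner_closed_span_eq0 _ (projector_in_closed_span e_odd_orthonormal x)).
move=> _ [k _ <-]; rewrite inner_e/=; case: eqP oddj => // <-.
by rewrite /= mul2n odd_double.
Qed.

Variable theta : nat -> R.

(* The generators of L1, with the index shifted so that it starts from 0. *)
Definition ray k : ell2 R :=
  cos (theta k.+1) *: e_ (2 * k).+1 + sin (theta k.+1) *: e_ (2 * k).+2.

Lemma inner_ray k x : inner (ray k) x =
  cos (theta k.+1) * x (2 * k).+1 + sin (theta k.+1) * x (2 * k).+2.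
Proof. by rewrite innerDl !innerZl !inner_e. Qed.

Lemma ray0 k : ray k 0%N = 0.
Proof. by rewrite ell2D !ell2Z/= !mulr0 addr0. Qed.

Lemma ray_odd k i : ray k (2 * i).+1 = cos (theta k.+1) * (i == k)%:R.
Proof.
rewrite ell2D !ell2Z/= !eqSS eqn_mul2l/=.
suff /negPf -> : (2 * i)%N != (2 * k).+1 by rewrite mulr0 addr0.
by apply/eqP => /(congr1 odd); rewrite /= !mul2n !odd_double.
Qed.

Lemma ray_even k i : ray k (2 * i).+2 = sin (theta k.+1) * (i == k)%:R.
Proof.
rewrite ell2D !ell2Z/= !eqSS eqn_mul2l/=.
suff /negPf -> : (2 * i).+1 != (2 * k)%N by rewrite mulr0 add0r.
by apply/eqP => /(congr1 odd); rewrite /= !mul2n !odd_double.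
Qed.

Lemma ray_orthonormal i j : inner (ray i) (ray j) = (i == j)%:R.
Proof.
rewrite inner_ray ray_odd ray_even; case: eqP => [->|_]; last by rewrite !mulr0 addr0.
by rewrite !mulr1 -!expr2 cos2Dsin2.
Qed.

Let P := projector (closed_span (range ray)).

Let ray_perp_eq0 x y : (forall k, inner (ray k) y = 0) -> inner (P x) y = 0.
Proof.
move=> h; apply: (inner_closed_span_eq0 _ (projector_in_closed_span ray_orthonormal x)).
by move=> _ [k _ <-].
Qed.

Lemma projector_ray0 x : projector (closed_span (range ray)) x 0%N = 0.
Proof.
rewrite -inner_e innerC; apply: ray_perp_eq0 => k.
by rewrite innerC inner_e ray0.
Qed.

(** The vector [cos e_(2k+2) - sin e_(2k+1)] is orthogonal to every ray, hence to [P x]. *)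
Let perp_coord x k :
  cos (theta k.+1) * P x (2 * k).+2 = sin (theta k.+1) * P x (2 * k).+1.
Proof.
apply/eqP; rewrite -subr_eq0 -!inner_e -!innerZl -innerNl -innerDl innerC.
apply/eqP/ray_perp_eq0 => i; rewrite innerC innerDl innerNl !innerZl !inner_e.
rewrite ray_even ray_odd; case: eqP => [->|_]; last by rewrite !mulr0 subrr.
by rewrite !mulr1 mulrC subrr.
Qed.

(** [perp_coord] trades the even coordinate for the odd one, and [cos^2 + sin^2 = 1] collects the
    two terms. *)
Lemma projector_ray_odd x k : projector (closed_span (range ray)) x (2 * k).+1 =
  cos (theta k.+1) * inner (ray k) x.
Proof.
rewrite -(inner_projector ray_orthonormal) inner_ray -/(P x) mulrDr.
rewrite mulrCA [cos _ * (sin _ * _)]mulrCA perp_coord -[LHS]mul1r.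
by rewrite -(cos2Dsin2 (theta k.+1)); ring.
Qed.

Lemma projector_ray_even x k : projector (closed_span (range ray)) x (2 * k).+2 =
  sin (theta k.+1) * inner (ray k) x.
Proof.
rewrite -(inner_projector ray_orthonormal) inner_ray -/(P x) mulrDr.
rewrite [sin _ * (cos _ * _)]mulrCA -perp_coord -[LHS]mul1r.
by rewrite -(cos2Dsin2 (theta k.+1)); ring.
Qed.

End ell2_coordinates.
Arguments cvg_sum_sqr {R} x.

(* This is what excludes the closedness of the sum: the weights s k - s k.+1
   are summable by telescoping, but not after division by s k ^+ 2. *)
Lemma telescope_quotient_diverges (R : realType) (s b : nat -> R) (c B : R) :
  (forall k, 0 < s k) -> nonincreasing_seq s -> s @ \oo --> 0 -> 0 < c ->
  (forall k, 0 <= b k) -> (forall n, \sum_(0 <= k < n) b k <= B) ->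
  ~ (forall k, c * (s k - s k.+1) <= s k ^+ 2 * b k).
Proof.
move=> s0 sdec scvg c0 b0 bB H.
have small e : 0 < e -> exists n, s n < e.
  move=> e0; move/cvgrPdist_lt: scvg => /(_ _ e0)[n _ /(_ n)] /(_ (leqnn n)).
  by rewrite sub0r normrN gtr0_norm// => sn; exists n.
have B0 : 0 <= B by apply: le_trans (bB 0%N); rewrite big_geq.
(* Sum [H] over [m <= k < m + n] with [s k <= s m]; the left side telescopes. *)
have tail m n : c * (s m - s (m + n)%N) <= s m ^+ 2 * B.
  apply: (@le_trans _ _ (s m ^+ 2 * \sum_(m <= k < m + n) b k)).
    rewrite -opprB -(telescope_sumr s (leq_addr n m)) -sumrN !mulr_sumr.
    apply: ler_sum_nat => k /andP[mk _]; rewrite opprB (le_trans (H k))//.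
    by rewrite ler_wpM2r// lerXn2r ?nnegrE ?(ltW (s0 _))// sdec.
  rewrite ler_wpM2l ?sqr_ge0// (le_trans _ (bB (m + n)%N))//.
  by rewrite (big_cat_nat (leq0n m) (leq_addr n m))/= lerDr sumr_ge0.
(* For [n] with [s (m + n) <= s m / 2], [tail] leaves [c * s m / 2 <= s m ^ 2 * B], and one factor
   [s m] cancels. This fails for large [m], as [s] tends to 0. *)
have half m : c / 2 <= s m * B.
  have [|n sn] := small (s m / 2); first by rewrite divr_gt0.
  have smn : s (m + n)%N <= s m / 2.
    by rewrite (le_trans _ (ltW sn))// sdec// leq_addl.
  rewrite -(ler_pM2l (s0 m)); apply: le_trans (_ : c * (s m / 2) <= _).
    by rewrite mulrC mulrAC -mulrA.
  rewrite [leRHS]mulrA -expr2; apply: le_trans (tail m n).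
  by rewrite ler_pM2l// lerBrDr -lerBrDl; lra.
have [|m sm] := small (c / 2 / (B + 1)).
  by rewrite !divr_gt0// ltr_wpDl.
have := half m; apply/negP; rewrite -ltNge.
apply: le_lt_trans (_ : s m * (B + 1) < _); first by rewrite ler_pM2l// lerDl.
by rewrite -ltr_pdivlMr// ltr_wpDl.
Qed.

Lemma orth_closed_span (R : realType) (V : hilbertType R) (A : set V) :
  orth (closed_span A) = orth A.
Proof.
apply/seteqP; split=> y /= Ay a Aa; last exact: inner_closed_span_eq0 Aa.
apply: Ay; apply: subset_closure; exists 1%N, (fun=> 1), (fun=> a).
by split=> //; rewrite big_ord1 scale1r.
Qed.

(** * Failure of innate regularity *)

Section regularity.
Variables (R : realType) (theta : nat -> R).
Hypothesis theta_range : forall n, 0 < theta n < pi / 2.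
Hypothesis theta_decr : nonincreasing_seq theta.
Hypothesis theta_cvg0 : theta @ \oo --> (0 : R).

Lemma cos_theta_gt0 n : 0 < cos (theta n).
Proof.
have /andP[t0 tpi] := theta_range n.
by rewrite cos_gt0_pihalf// tpi (lt_trans _ t0)// oppr_lt0 divr_gt0 ?pi_gt0.
Qed.

Let s k := sin (theta k.+1).

Let s_gt0 k : 0 < s k.
Proof. exact: sin_gt0_pihalf. Qed.

Let theta_itv a : theta a \in `[0, pi].
Proof.
have /andP[t0 tpi] := theta_range a; rewrite in_itv/= ltW//=.
by rewrite (le_trans (ltW tpi))// ler_pdivrMr// ler_peMr ?pi_ge0// ler1n.
Qed.

Let cos_theta_le m n : (m <= n)%N -> cos (theta m) <= cos (theta n).
Proof.
by move=> mn; rewrite leNgt ltr_cos// -leNgt theta_decr.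
Qed.

(** The cosines increase along the decreasing angles, and [sin^2 = 1 - cos^2]. *)
Let s_decr : nonincreasing_seq s.
Proof.
move=> m n mn; have := @cos_theta_le m.+1 n.+1 mn.
rewrite -(ler_pXn2r (n := 2))// ?nnegrE ?(ltW (cos_theta_gt0 _))//.
rewrite !cos2sin2 lerD2l lerN2 ler_pXn2r// nnegrE; exact/ltW/s_gt0.
Qed.

Let s_cvg0 : s @ \oo --> 0.
Proof.
rewrite -[X in _ --> X]sin0.
apply: (@continuous_cvg _ _ _ _ _ _ (@sin R)); first exact: continuous_sin.
by rewrite (cvg_shiftS theta).
Qed.

Let d j := if odd j then Num.sqrt (s j./2 - s j./2.+1) else 0.

Let d_odd k : d (2 * k).+1 = Num.sqrt (s k - s k.+1).
Proof. by rewrite /d /= mul2n odd_double /= uphalf_double. Qed.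

Let d_even k : d (2 * k).+2 = 0.
Proof. by rewrite /d /= mul2n odd_double. Qed.

Let d_odd_sqr k : d (2 * k).+1 ^+ 2 = s k - s k.+1.
Proof. by rewrite d_odd sqr_sqrtr// subr_ge0 s_decr. Qed.

(** The partial sum up to [n] is at most the one up to [2n + 1], which splits into pairs and
    telescopes to [s 0 - s n]. *)
Let d_summable : square_summable d.
Proof.
apply: nondecreasing_is_cvgn.
  by apply: nondecreasing_series => n _ _; exact: sqr_ge0.
exists (s 0%N) => _ [n _ <-]; rewrite /series/=.
apply: (@le_trans _ _ (\sum_(0 <= j < (2 * n).+1) d j ^+ 2)).
  have nn : (n <= (2 * n).+1)%N by rewrite mul2n -addnn leqW// leq_addr.
  rewrite (big_cat_nat (leq0n n) nn)/= lerDl.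
  by rewrite sumr_ge0// => j _; exact: sqr_ge0.
rewrite (sum_nat_double (fun j => d j ^+ 2)) {1}/d/= expr0n add0r.
under eq_bigr do rewrite d_odd_sqr d_even expr0n addr0 -opprB.
by rewrite sumrN telescope_sumr// opprB gerBl ltW.
Qed.

Lemma not_innately_regular : ~ innately_regular
  [set closed_span (range (ray theta));
       closed_span (range (fun k => e_ (2 * k).+1))].
Proof.
set L1 := closed_span (range (ray theta)).
set L2 := closed_span _ => reg.
pose S := minkowski_sum (fun i : 'I_2 => orth (if i == ord0 then L1 else L2)).
have clS : closed S by apply: reg => i; case: ifP => _; [left|right].
pose x : ell2 R := Ell2 (introT (square_summableP _) d_summable).
have Sx : S x.
  have xE : projector L2 x = x.
    by apply: ell2P => j; rewrite projector_odd -[x j]/(d j) /d; case: (odd j).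
  have := cvg_projector (@e_odd_orthonormal R) x; rewrite -/L2 xE.
  apply: (closed_cvg _ clS) => //; apply: nearW => n.
  (* This cotangent makes [e_(2k+1) - r k e_(2k+2)] orthogonal to [ray k]; the compensating
     [r k e_(2k+2)] is orthogonal to L2. Hence the partial sums of [x] lie in [S], and so does [x],
     as [S] is closed. *)
  pose r k := cos (theta k.+1) / s k.
  pose u0 : ell2 R := \sum_(0 <= k < n) inner x (e_ (2 * k).+1) *:
     (e_ (2 * k).+1 - r k *: e_ (2 * k).+2).
  pose u1 : ell2 R :=
    \sum_(0 <= k < n) inner x (e_ (2 * k).+1) *: (r k *: e_ (2 * k).+2).
  exists (fun i => if i == ord0 then u0 else u1); split; last first.
    rewrite big_ord_recl big_ord1/= -big_split/=.
    by apply: eq_bigr => k _; rewrite -scalerDr subrK.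
  move=> i; case: ifP => _; rewrite orth_closed_span => _ [j _ <-].
    rewrite inner_sumr big1// => k _; rewrite innerZr innerBr innerZr.
    rewrite !(innerC (ray _ _)) !inner_e ray_odd ray_even.
    case: eqP => [->|_]; last by rewrite !mulr0 subrr mulr0.
    by rewrite !mulr1 divfK ?gt_eqF// subrr mulr0.
  rewrite inner_sumr big1// => k _; rewrite !innerZr inner_e/= eqSS.
  suff /negPf -> : (2 * j)%N != (2 * k).+1 by rewrite !mulr0.
  by apply/eqP => /(congr1 odd); rewrite /= !mul2n !odd_double.
case: Sx => u [Su xu].
have {Su} [u0 u1] : orth L1 (u ord0) /\ orth L2 (u (lift ord0 ord0)).
  by split; [have := Su ord0 | have := Su (lift ord0 ord0)].
move: u0 u1; rewrite !orth_closed_span => u0 u1.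
rewrite big_ord_recl big_ord1 in xu.
set y := u ord0 in u0 xu; set z := u _ in u1 xu.
(* The summand [z] is orthogonal to L2, so it has no odd coordinates and [y] carries all those of
   [x]. *)
have y_odd k : y (2 * k).+1 = d (2 * k).+1.
  rewrite -[d _]/(x _) xu ell2D -[z _]inner_e u1 ?addr0//.
have y_even k : s k * y (2 * k).+2 = - (cos (theta k.+1) * d (2 * k).+1).
  apply/eqP; rewrite -addr_eq0 addrC -y_odd -inner_ray u0//.
pose b k := y (2 * k).+2 ^+ 2.
(* Among the angles with positive index, [theta 1] has the smallest cosine, which gives a constant
   uniform in [k]. *)
apply: (@telescope_quotient_diverges _ s b (cos (theta 1) ^+ 2) (`|y| ^+ 2)) => //.
- by rewrite exprn_gt0// cos_theta_gt0.
- by move=> k; exact: sqr_ge0.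
- move=> n; apply: le_trans (_ : \sum_(0 <= j < (2 * n).+1) y j ^+ 2 <= _).
    rewrite (sum_nat_double (fun j => y j ^+ 2)) ler_wpDl ?sqr_ge0//.
    by apply: ler_sum => k _; rewrite lerDr sqr_ge0.
  by rewrite -innerxx; exact: ell2_partial_le.
- move=> k; rewrite -exprMn y_even sqrrN exprMn d_odd_sqr.
  rewrite ler_wpM2r ?subr_ge0 ?s_decr// ler_pXn2r// ?nnegrE ?(ltW (cos_theta_gt0 _))//.
  exact: cos_theta_le.
Qed.

End regularity.

(** * Closed forms for the alternating projections *)

Section iterates.
Variables (R : realType) (theta : nat -> R) (x : ell2 R) (xs : nat -> ell2 R).
Hypothesis xs0 : forall j, xs 0%N j = if odd j then x j else 0.
Hypothesis xs_odd : forall n,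
  xs (2 * n).+1 = projector (closed_span (range (ray theta))) (xs (2 * n)%N).
Hypothesis xs_even : forall n, xs (2 * n).+2 =
  projector (closed_span (range (fun k => e_ (2 * k).+1))) (xs (2 * n).+1).

(** Each round multiplies an odd coordinate by [cos^2]: one factor comes from the inner product with
    the ray, the other from the ray's own odd coordinate. *)
Lemma even_iterate n j : xs (2 * n)%N j =
  if odd j then x j * cos (theta j./2.+1) ^+ (2 * n) else 0.
Proof.
elim: n => [|n IH] in j *; first by rewrite muln0 xs0 expr0 mulr1.
rewrite mulnS xs_even projector_odd; case: ifP => // oddj.
have jE : j = (2 * j./2).+1 by rewrite mul2n -[LHS]odd_double_half oddj.
rewrite [in LHS]jE xs_odd projector_ray_odd inner_ray !IH -jE /= oddj/=.
by rewrite mulr0 addr0 !exprS; ring.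
Qed.

Lemma odd_iterate0 n : xs (2 * n).+1 0%N = 0.
Proof. by rewrite xs_odd projector_ray0. Qed.

Let inner_even_iterate n k : inner (ray theta k) (xs (2 * n)%N) =
  cos (theta k.+1) ^+ (2 * n).+1 * x (2 * k).+1.
Proof.
rewrite inner_ray !even_iterate/= mul2n odd_double/= uphalf_double mulr0 addr0.
by rewrite exprS; ring.
Qed.

Lemma odd_iterate_odd n k : xs (2 * n).+1 (2 * k).+1 =
  x (2 * k).+1 * cos (theta k.+1) ^+ (2 * n).+2.
Proof.
by rewrite xs_odd projector_ray_odd inner_even_iterate [in RHS]exprS; ring.
Qed.

Lemma odd_iterate_even n k : xs (2 * n).+1 (2 * k).+2 =
  x (2 * k).+1 * cos (theta k.+1) ^+ (2 * n).+1 * sin (theta k.+1).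
Proof. by rewrite xs_odd projector_ray_even inner_even_iterate; ring. Qed.

Hypothesis cos_gt0 : forall n, 0 < cos (theta n).

(** Odd coordinates cancel in the difference. The even ones have squares [x^2 cos^(4n+2) sin^2], and
    [sin^2 = cos^2 (cos^-2 - 1)]. *)
Lemma cvg_even_step n :
  (fun m => \sum_(0 <= k < m) x (2 * k).+1 ^+ 2 * cos (theta k.+1) ^+ (4 * n.+1) *
    (cos (theta k.+1) ^- 2 - 1)) @ \oo --> `|xs (2 * n).+2 - xs (2 * n).+1| ^+ 2.
Proof.
pose y : ell2 R := xs (2 * n).+2 - xs (2 * n).+1; rewrite -/y.
have xsS : xs (2 * n).+2 = xs (2 * n.+1)%N by rewrite mulnS.
have yE j : y j = xs (2 * n).+2 j - xs (2 * n).+1 j by exact: ell2B.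
clearbody y.
(* Partial sums of the squared norm are taken along [2m + 1] only, so that they split into pairs. *)
have sub : (fun m => (2 * m).+1) @ \oo --> \oo.
  move=> A [N _ NA]; exists N => // m /= Nm; apply: NA => /=.
  by rewrite mul2n -addnn leqW// (leq_trans Nm)// leq_addr.
apply: cvg_trans (cvg_comp _ _ sub (cvg_sum_sqr y)).
apply: near_eq_cvg; apply: nearW => m /=.
rewrite (sum_nat_double (fun j => y j ^+ 2)) yE odd_iterate0 subr0.
rewrite xsS even_iterate/= expr0n add0r; apply/esym/eq_bigr => k _.
rewrite !yE xsS odd_iterate_odd odd_iterate_even !even_iterate/=.
rewrite mul2n odd_double/= uphalf_double -mul2n.
have c0 : cos (theta k.+1) != 0 by rewrite gt_eqF.
have nS : (2 * n.+1 = (2 * n).+2)%N by rewrite mulnS.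
have -> : (4 * n.+1 = (2 * n).+2 * 2)%N by rewrite -nS mulnAC.
rewrite nS subrr sub0r sqrrN expr0n add0r !exprMn sin2cos2 exprM [_ ^+ (2 * n).+2]exprS.
by field.
Qed.

(** All terms of the series are nonnegative because [0 < cos <= 1], so each one is at most the
    sum. *)
Lemma even_step_ge n k :
  x (2 * k).+1 ^+ 2 * cos (theta k.+1) ^+ (4 * n.+1) *
    (cos (theta k.+1) ^- 2 - 1) <= `|xs (2 * n).+2 - xs (2 * n).+1| ^+ 2.
Proof.
have c := @cvg_even_step n; rewrite -(cvg_lim _ c)//.
have t0 i : 0 <= x (2 * i).+1 ^+ 2 * cos (theta i.+1) ^+ (4 * n.+1) *
    (cos (theta i.+1) ^- 2 - 1).
  have ci := ltW (cos_gt0 i.+1).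
  apply: mulr_ge0; first by rewrite mulr_ge0 ?sqr_ge0 ?exprn_ge0.
  by rewrite subr_ge0 invf_ge1 ?exprn_gt0//.
apply: le_trans (nondecreasing_cvgn_le _ (cvgP _ c) k.+1).
  by rewrite big_nat_recr//= lerDr sumr_ge0.
by apply: nondecreasing_series => i _ _; exact: t0.
Qed.

End iterates.

(** * Exponential lower bounds and divergence of the series of powers *)

Section divergence.
Variable R : realType.

Lemma acos_powR_range (k : nat) (a : R) : (0 < k)%N -> 0 <= a ->
  -1 <= (k%:R / k.+1%:R) `^ a <= 1.
Proof.
move=> k0 a0; rewrite (le_trans _ (powR_ge0 _ _)) ?lerN10//=.
rewrite -[leRHS](powRr0 (k%:R / k.+1%:R)); apply: ger_powR => //.
by rewrite divr_gt0 ?ltr0n//= ler_pdivrMr ?ltr0n// mul1r ler_nat.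
Qed.

(** Here [c] is the cosine of the prescribed angle. Since [c^(4E) = q], having [n <= E] gives
    [c^(4n) >= q]. From [exp t >= 1 + t] and [- ln q >= 1 - q] follows
    [c^-2 - 1 >= (1 - q) / (2E)]. *)
Lemma angle_lower_bound (k n : nat) :
  let c : R := (k%:R / k.+1%:R) `^ (1 / (4 * expR k%:R)) in
  (0 < k)%N -> n%:R <= expR k%:R :> R ->
  (8 * k%:R * expR k%:R)^-1 <= c ^+ (4 * n) * (c ^- 2 - 1).
Proof.
set E := expR _; set q := _ / _; set a := _ / _ => c k0 nE.
have E0 : 0 < E by exact: expR_gt0.
have k1 : 1 <= k%:R :> R by rewrite ler1n.
have kS : k.+1%:R = k%:R + 1 :> R by rewrite -natr1.
have kp : 0 < k%:R + 1 :> R by lra.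
have q0 : 0 < q by rewrite divr_gt0 ?ltr0n.
have q1 : q <= 1 by rewrite ler_pdivrMr// mul1r ler_nat.
have qB : 1 - q = 1 / (k%:R + 1) by rewrite /q kS; field; rewrite gt_eqF.
have c_ge : q <= c ^+ (4 * n).
  rewrite -powR_mulrn ?powR_ge0// -powRrM -[leLHS]powRr1; last exact: ltW.
  apply: ger_powR; first by rewrite q0.
  rewrite /a natrM mulrAC mul1r ler_pdivrMr ?mulr_gt0//.
  by rewrite mul1r ler_pM2l.
have c_inv : 1 / (2 * E) * (1 - q) <= c ^- 2 - 1.
  have -> : c ^- 2 = expR (2 * (a * - ln q)).
    by rewrite mulrN mulrN expRN expRM_natl /c /powR gt_eqF.
  apply: le_trans (_ : 2 * (a * - ln q) <= _); last by rewrite lerBrDl expR_ge1Dx.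
  have -> : 1 / (2 * E) = 2 * a by rewrite /a; field; rewrite gt_eqF.
  rewrite -mulrA ler_pM2l// ler_wpM2l ?divr_ge0 ?mulr_ge0// ?expR_ge0//.
  rewrite lerNr opprB -{1}[q](subrKC 1) le_ln1Dx//; lra.
apply: le_trans (_ : q * (1 / (2 * E) * (1 - q)) <= _); last first.
  apply: ler_pM => //; first exact: ltW.
  by rewrite mulr_ge0 ?subr_ge0// divr_ge0// mulr_ge0// expR_ge0.
rewrite qB /q kS.
have -> : k%:R / (k%:R + 1) * (1 / (2 * E) * (1 / (k%:R + 1))) =
    (2 * (k%:R + 1) ^+ 2 / k%:R * E)^-1.
  by field; rewrite !gt_eqF// ltr0n.
(* What remains is [(k + 1)^2 <= 4 k^2], true for [k >= 1]. *)
rewrite lef_pV2 ?posrE ?mulr_gt0 ?invr_gt0 ?exprn_gt0 ?ltr0n//.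
rewrite ler_pM2r// ler_pdivrMr ?ltr0n//; nra.
Qed.

(** Raise the hypothesis to the power [g / 2 <= 1]. The polynomial factor is at most 1, so dropping
    its exponent only lowers the bound. *)
Lemma powR_step_lower_bound (k : nat) (d g : R) : (0 < k)%N -> 0 <= d ->
  0 < g < 2 -> (8 * k%:R ^+ 5 * expR k%:R)^-1 <= d ^+ 2 ->
  (8 * k%:R ^+ 5)^-1 * expR (- (g / 2 * k%:R)) <= d `^ g.
Proof.
move=> k0 d0 /andP[g0 g2] hd.
have [h0 h1] : 0 <= g / 2 /\ g / 2 <= 1 by split; lra.
have k1 : 1 <= k%:R :> R by rewrite ler1n.
have b1 : 1 <= 8 * k%:R ^+ 5 :> R by rewrite mulr_ege1// ?exprn_ege1// ler1n.
have b0 : 0 < 8 * k%:R ^+ 5 :> R by exact: lt_le_trans b1.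
have -> : d `^ g = (d ^+ 2) `^ (g / 2).
  by rewrite -powR_mulrn// -powRrM mulrCA divff ?mulr1.
apply: le_trans (ge0_ler_powR h0 _ _ hd); rewrite ?nnegrE ?sqr_ge0//.
rewrite [(_ * expR _)^-1]invfM powRM ?invr_ge0 ?expR_ge0 ?(ltW b0)//.
apply: ler_pM; rewrite ?invr_ge0 ?expR_ge0 ?(ltW b0)//.
  rewrite -[leLHS]powRr1 ?invr_ge0 ?(ltW b0)//.
  by apply: ger_powR => //; rewrite invr_gt0 b0 invf_le1.
by rewrite -expRN -expRM mulNr mulrC.
Qed.

(* About expR k odd-indexed steps have length at least (8 k^5 expR k)^(-1/2);
   since g < 2, their total contribution is unbounded as k grows. *)
Lemma nneseries_powR_pinfty (d : nat -> R) (g : R) : (forall n, 0 <= d n) ->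
  0 < g < 2 ->
  (forall k n, (0 < k)%N -> n.+1%:R <= expR k%:R :> R ->
    (8 * k%:R ^+ 5 * expR k%:R)^-1 <= d (2 * n).+1 ^+ 2) ->
  (\sum_(0 <= n <oo) (d n `^ g)%:E = +oo)%E.
Proof.
move=> d0 g02 hd; have /andP[g0 g2] := g02.
(* With this [a], [exp((1 - g/2) k)] is [exp(k a)^6], at least [(k a)^6]; a sixth power outgrows
   [k^5] and leaves a bound linear in [k]. *)
pose a := (1 - g / 2) / 6.
have a0 : 0 < a by rewrite /a; lra.
have sum_ge k : (0 < k)%N ->
    ((k%:R * a ^+ 6 / 16)%:E <= \sum_(0 <= n <oo) (d n `^ g)%:E)%E.
  move=> k0; pose M := Num.truncn (expR k%:R : R).
  have k0' : 0 < k%:R :> R by rewrite ltr0n.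
  have /andP[Mle Mgt] := truncn_itv (expR_ge0 (k%:R : R)).
  have E1 : 1 <= expR k%:R :> R by rewrite -[leLHS]expR0 ler_expR ltW.
  (* Since [M >= 1], [expR k < M + 1 <= 2 M]. *)
  have M2 : expR k%:R / 2 <= M%:R :> R.
    have : 1 <= M%:R :> R.
      by rewrite ler1n lt0n; apply/eqP => M0; move: Mgt; rewrite -/M M0 ltNge E1.
    by move: Mgt; rewrite -/M -natr1; lra.
  apply: le_trans (nneseries_lim_ge (2 * M).+1 _); last first.
    by move=> n _ _; rewrite lee_fin powR_ge0.
  rewrite sumEFin lee_fin (sum_nat_double (fun n => d n `^ g)) ler_wpDl ?powR_ge0//.
  pose t : R := (8 * k%:R ^+ 5)^-1 * expR (- (g / 2 * k%:R)).
  have t0 : 0 <= t by rewrite mulr_ge0 ?expR_ge0// invr_ge0 mulr_ge0// exprn_ge0 ?ltW.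
  (* Only the steps of index [2n + 1] are kept, each contributing at least [t]. *)
  apply: le_trans (_ : \sum_(0 <= n < M) t <= _); last first.
    apply: ler_sum_nat => n /= nM; rewrite ler_wpDr ?powR_ge0//.
    apply: powR_step_lower_bound => //; apply: hd => //.
    by rewrite (le_trans _ Mle)// ler_nat.
  rewrite sumr_const_nat subn0 -[leRHS]mulr_natl.
  apply: le_trans (ler_wpM2r t0 M2).
  have -> : expR k%:R / 2 * t = expR (k%:R * a) ^+ 6 / (16 * k%:R ^+ 5).
    rewrite -expRM_natl (_ : 6 * _ = k%:R + - (g / 2 * k%:R)).
      2: by rewrite /a; field.
    by rewrite expRD /t; field; rewrite gt_eqF.
  apply: le_trans (_ : (k%:R * a) ^+ 6 / (16 * k%:R ^+ 5) <= _).
    by rewrite le_eqVlt; apply/predU1P; left; field; rewrite gt_eqF.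
  rewrite ler_wpM2r ?invr_ge0 ?mulr_ge0 ?exprn_ge0 ?(ltW k0')//.
  have ka0 : 0 <= k%:R * a by rewrite mulr_ge0// ltW.
  rewrite lerXn2r ?nnegrE ?expR_ge0//.
  by apply: le_trans (expR_ge1Dx _); rewrite lerDr.
apply: eq_infty => r; pose k := (Num.truncn (`|r| * 16 / a ^+ 6)).+1.
apply: le_trans (sum_ge k _) => //; rewrite lee_fin (le_trans (ler_norm r))//.
have : `|r| * 16 / a ^+ 6 < k%:R by exact: truncnS_gt.
by rewrite ltr_pdivrMr ?exprn_gt0// ler_pdivlMr// => /ltW.
Qed.

End divergence.

(** * Assembly of the six claims, after shifting indices to start from 0 *)

Theorem mainTheorem2 (R : realType) (theta : nat -> R) (L1 L2 : set (ell2 R))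
  (theta_range : forall n, 0 < theta n < pi / 2)
  (theta_decr : nonincreasing_seq theta)
  (theta_cvg0 : theta @ \oo --> (0 : R))
  (L1E : L1 = closed_span
    [set v | exists2 k, (0 < k)%N &
       v = cos (theta k) *: e_ (2 * k - 1) + sin (theta k) *: e_ (2 * k)])
  (L2E : L2 = closed_span [set v | exists k, v = e_ (2 * k + 1)]) :
  [/\ (* (i) *)
      forall x : ell2 R,
        (fun n => \sum_(1 <= k < n)
           (x (2 * k - 1)%N * cos (theta k) + x (2 * k)%N * sin (theta k)) *:
           (cos (theta k) *: e_ (2 * k - 1) + sin (theta k) *: e_ (2 * k)))
          @ \oo --> projector L1 x,
      (* (ii) *)
      forall (x : ell2 R) j, projector L2 x j = if odd j then x j else 0,
      (* (iii) *)
      ~ innately_regular [set L1; L2] &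
      forall (x : ell2 R) (xs : nat -> ell2 R)
        (xs0 : forall j, xs 0%N j = if odd j then x j else 0)
        (xs_odd : forall n, xs (2 * n + 1)%N = projector L1 (xs (2 * n)%N))
        (xs_even : forall n, xs (2 * n + 2)%N = projector L2 (xs (2 * n + 1)%N)),
      [/\ (* (iv) *)
          forall n k, (0 < n)%N -> (0 < k)%N ->
            [/\ xs (2 * n - 1)%N 0%N = 0,
                xs (2 * n - 1)%N (2 * k - 1)%N =
                  x (2 * k - 1)%N * cos (theta k) ^+ (2 * n),
                xs (2 * n - 1)%N (2 * k)%N =
                  x (2 * k - 1)%N * cos (theta k) ^+ (2 * n - 1) *
                  sin (theta k),
                xs (2 * n)%N (2 * k - 2)%N = 0 &
                xs (2 * n)%N (2 * k - 1)%N =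
                  x (2 * k - 1)%N * cos (theta k) ^+ (2 * n)],
          (* (v) *)
          forall n, (0 < n)%N ->
            (fun m => \sum_(1 <= k < m)
               x (2 * k - 1)%N ^+ 2 * cos (theta k) ^+ (4 * n) *
               (cos (theta k) ^- 2 - 1))
              @ \oo --> `|xs (2 * n)%N - xs (2 * n - 1)%N| ^+ 2 &
          (* (vi) *)
          0 < theta 0%N < pi / 2 ->
          (forall k, (0 < k)%N ->
             theta k = acos ((k%:R / k.+1%:R) `^ (1 / (4 * expR k%:R)))) ->
          (forall k, (0 < k)%N -> x (2 * k - 1)%N = 1 / k%:R ^+ 2) ->
          forall gamma : R, 0 < gamma < 2 ->
            (\sum_(0 <= n <oo) (`|xs n.+1 - xs n| `^ gamma)%:E = +oo)%E]].
Proof.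
(* Replacing a positive [k] by [k.+1] removes the truncated subtraction from the indices. *)
have idx1 k : (2 * k.+1 - 1 = (2 * k).+1)%N by rewrite mulnS subn1.
have idx2 k : (2 * k.+1 = (2 * k).+2)%N by rewrite mulnS.
have -> : L1 = closed_span (range (ray theta)).
  rewrite L1E; congr closed_span; apply/seteqP; split=> [v [[//|k] _ ->]|_ [k _ <-]].
    by exists k => //; rewrite idx1 idx2.
  by exists k.+1 => //; rewrite idx1 idx2.
have -> : L2 = closed_span (range (fun k => e_ (2 * k).+1)).
  rewrite L2E; congr closed_span; apply/seteqP; split=> [v [k ->]|_ [k _ <-]].
    by exists k => //; rewrite addn1.
  by exists k; rewrite addn1.
have cos_gt0 := cos_theta_gt0 theta_range.
split.
- move=> x; rewrite -cvg_shiftS.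
  have := cvg_projector (ray_orthonormal theta) x.
  apply: cvg_trans; apply: near_eq_cvg; apply: nearW => n /=.
  rewrite big_add1/=; apply: eq_bigr => k _.
  by rewrite innerC inner_ray idx1 idx2 [cos _ * _]mulrC [sin _ * _]mulrC.
- exact: projector_odd.
- exact: not_innately_regular.
move=> x xs xs0 xs_odd' xs_even'.
have xs_odd n : xs (2 * n).+1 =
    projector (closed_span (range (ray theta))) (xs (2 * n)%N).
  by rewrite -addn1 xs_odd'.
have xs_even n : xs (2 * n).+2 =
    projector (closed_span (range (fun k => e_ (2 * k).+1))) (xs (2 * n).+1).
  by rewrite -addn2 xs_even' addn1.
split.
- move=> [//|n] [//|k] _ _.
  have idx3 : (2 * k.+1 - 2 = 2 * k)%N by rewrite idx2 subn2.
  rewrite !idx1 idx3 (odd_iterate0 xs_odd).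
  rewrite [(2 * k.+1)%N]idx2 (odd_iterate_odd xs0 xs_odd xs_even).
  rewrite (odd_iterate_even xs0 xs_odd xs_even) -!idx2.
  by rewrite !(even_iterate xs0 xs_odd xs_even)/= mul2n odd_double/= uphalf_double.
- move=> [//|n] _; rewrite -cvg_shiftS idx1 idx2.
  have := cvg_even_step xs0 xs_odd xs_even cos_gt0 (n := n).
  apply: cvg_trans; apply: near_eq_cvg; apply: nearW => m /=.
  by rewrite big_add1/=; apply: eq_bigr => k _; rewrite idx1.
move=> _ theta_def x_def g g02; apply: (@nneseries_powR_pinfty _ _ g) => // k n.
case: k => [//|k] _ nk.
apply: le_trans (even_step_ge xs0 xs_odd xs_even cos_gt0 n k).
rewrite -idx1 x_def// theta_def// acosK; last first.
  by rewrite in_itv/= acos_powR_range// divr_ge0// mulr_ge0// expR_ge0.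
rewrite -[leRHS]mulrA.
apply: le_trans (ler_wpM2l (sqr_ge0 _) (@angle_lower_bound R k.+1 n.+1 isT nk)).
(* The squared coordinate [1 / k^4] times the angle bound [1 / (8 k exp k)] is exactly the required
   [1 / (8 k^5 exp k)], at [k.+1]. *)
rewrite le_eqVlt; apply/predU1P; left; field.
by rewrite !gt_eqF ?ltr0n ?expR_gt0.
Qed.
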